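(* Let $(\Omega,\mathcal{E},\mathrm{P})$ be a complete Rényi space, let $\mathcal{H}$ be a separable complex Hilbert space, and let $X$ be a random closed operator in $\mathcal{H}$, that is, a random operator such that for each $\omega\in\Omega$, $X(\omega)$ is a closed linear operator from a linear subspace $\mathrm{Dom}(X(\omega))\subseteq\mathcal{H}$ into $\mathcal{H}$. For $\omega\in\Omega$ let $\Sigma_p(\omega)\subseteq\mathbb{C}$ denote the set of eigenvalues of $X(\omega)$ and let $\Sigma(\omega)\subseteq\mathbb{C}$ denote the spectrum of $X(\omega)$. Then: (1) The eigenvalue spectrum $\omega\mapsto\Sigma_p(\omega)$ and the spectrum $\omega\mapsto\Sigma(\omega)$ are random sets in $\mathbb{C}$; that is, for every open set $U\subseteq\mathbb{C}$ the sets $\{\omega\in\Omega : \Sigma_p(\omega)\cap U\neq\emptyset\}$ and $\{\omega\in\Omega : \Sigma(\omega)\cap U\neq\emptyset\}$ belong to $\mathcal{E}$. (2) If, furthermore, $X$ is unitarily invariant with respect to a metrically transitive system $\mathcal{T}$ of measurable transformations acting on $\Omega$, then both the closure of the eigenvalue spectrum and the spectrum are represented by fixed sets; that is, there exist fixed (non-random) closed sets $F_p,F\subseteq\mathbb{C}$ such that $\overline{\Sigma_p(\omega)}=F_p$ for $\mathrm{P}$-almost all $\omega$ and $\Sigma(\omega)=F$ for $\mathrm{P}$-almost all $\omega$.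
   Context: **Rényi space.** A Rényi space $(\Omega,\mathcal{E},\mathrm{P})$ consists of a measurable space $(\Omega,\mathcal{E})$ with a Rényi state, represented by a nonzero $\sigma$-finite measure $\mathrm{P}$ (not necessarily a probability measure, possibly of infinite total mass; the Rényi state determines $\mathrm{P}$ up to a positive multiplicative constant). The elements of $\mathcal{E}$ are called events. A zero set is an event $A$ with $\mathrm{P}(A)=0$. The space is complete if every subset of a zero set is an event. ''Almost all $\omega$'' means all $\omega$ outside a zero set. **Random set.** A random set in a topological space $S$ is a map $Y$ from $\Omega$ to the set of subsets of $S$ such that $\{\omega : Y(\omega)\cap U\neq\emptyset\}\in\mathcal{E}$ for every open $U\subseteq S$. The sets $Y(\omega)$ need not be closed and may be empty. **Random operator.** A random operator $X$ in a separable Hilbert space $\mathcal{H}$ is a map assigning to each $\omega\in\Omega$ a linear operator $X(\omega):\mathrm{Dom}(X(\omega))\to\mathcal{H}$, defined on a linear subspace $\mathrm{Dom}(X(\omega))\subseteq\mathcal{H}$, such that the graph $\omega\mapsto\{(f,X(\omega)f) : f\in\mathrm{Dom}(X(\omega))\}$ is a random set in $\mathcal{H}\times\mathcal{H}$. The operators may be unbounded, their domains may depend on $\omega$, and they need not be densely defined. It is a random closed operator if the graph of $X(\omega)$ is closed in $\mathcal{H}\times\mathcal{H}$ for each $\omega$. **Spectra.** The eigenvalue spectrum of a closed operator $T$ in $\mathcal{H}$ is the set of $z\in\mathbb{C}$ for which there is $f\in\mathrm{Dom}(T)$, $f\neq 0$, with $Tf=zf$. The spectrum of $T$ is the set of $z\in\mathbb{C}$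 such that $T-z:\mathrm{Dom}(T)\to\mathcal{H}$ is not a bijection (for closed $T$ a bijective $T-z$ automatically has a bounded inverse). **Metric transitivity and unitary invariance.** A system $\mathcal{T}$ of measurable transformations $\tau:\Omega\to\Omega$ is metrically transitive if every event $A$ such that, for every $\tau\in\mathcal{T}$, $\tau^{-1}(A)$ equals $A$ up to a zero set satisfies $\mathrm{P}(A)=0$ or $\mathrm{P}(\Omega\setminus A)=0$. The random operator $X$ is unitarily invariant with respect to $\mathcal{T}$ if for every $\tau\in\mathcal{T}$ and almost all $\omega$ the operators $X(\tau\omega)$ and $X(\omega)$ are unitarily equivalent, i.e. there is a unitary operator $V$ on $\mathcal{H}$ (which may depend on $\tau$ and $\omega$) with $X(\tau\omega)=V X(\omega)V^{*}$, including equality of domains. *)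

(* Defs.v *)
From HB Require Import structures.
From mathcomp Require Import all_boot all_order all_algebra.
From mathcomp Require Import all_classical all_reals all_analysis.
From mathcomp Require Import complex.

Set Implicit Arguments.
Unset Strict Implicit.
Unset Printing Implicit Defensive.

Import Order.TTheory GRing.Theory Num.Theory.
Import numFieldNormedType.Exports.

Local Open Scope classical_set_scope.
Local Open Scope ring_scope.

(* The complex numbers as a normed space over themselves; the regular module
   [^o] is where the library puts the norm topology of a concrete field. *)
Notation CC R := (R[i]^o)%type (only parsing).

(* A Rényi state is a class of measures up to positive scalars; it is
   represented here by a member of the class.  None of the notions below
   depends on the choice of that member. *)
Definition renyi_measure d (Omega : measurableType d) (R : realType)
    (P : {measure set Omega -> \bar R}) : Prop :=
  sigma_finite [set: Omega] P /\ P [set: Omega] <> 0%E.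

Definition random_set d (Omega : measurableType d) (S : topologicalType)
    (Y : Omega -> set S) : Prop :=
  forall U : set S, open U -> measurable [set w | Y w `&` U !=set0].

Definition metrically_transitive d (Omega : measurableType d) (R : realType)
    (P : {measure set Omega -> \bar R}) (Tau : set (Omega -> Omega)) : Prop :=
  forall A : set Omega, measurable A ->
    (forall tau, Tau tau -> P ((tau @^-1` A) `+` A) = 0%E) ->
    P A = 0%E \/ P (~` A) = 0%E.

Definition separable (S : topologicalType) : Prop :=
  exists2 D : set S, countable D & dense D.

(* A Hilbert space is a complete normed space whose norm comes from an inner
   product (conjugate-linear in its second argument). *)
Definition induces_norm (R : realType) (H : normedModType R[i])
    (dot : {dot H for Num.conj}) : Prop :=
  forall f : H, `|f| ^+ 2 = dot f f.

(* An operator with domain: only the values of [oper_fun] on [Dom] are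
   meaningful, those elsewhere are arbitrary and are never used. *)
Record operator (R : realType) (H : lmodType R[i]) := Operator {
  Dom : set H;
  oper_fun :> H -> H;
  Dom_submod : GRing.submod_closed (mem Dom);
  oper_linear : forall (a : R[i]) (f g : H), Dom f -> Dom g ->
    oper_fun (a *: f + g) = a *: oper_fun f + oper_fun g
}.

Definition graph (R : realType) (H : lmodType R[i]) (T : operator H) :
  set (H * H) := [set (f, T f) | f in Dom T].

Definition closed_operator (R : realType) (H : normedModType R[i])
  (T : operator H) : Prop := closed (graph T).

Definition eigenvalues (R : realType) (H : lmodType R[i]) (T : operator H) :
    set (CC R) :=
  [set z : R[i] | exists f : H, [/\ Dom T f, f != 0 & T f = z *: f]].

(* For closed [T], bijectivity of T - z already makes its inverse bounded. *)
Definition spectrum (R : realType) (H : lmodType R[i]) (T : operator H) :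
    set (CC R) :=
  [set z : R[i] | ~ set_bij (Dom T) [set: H] (fun f => T f - z *: f)].

(* No continuity is required: these conditions make [V] and [V'] isometries. *)
Definition unitary_with_adjoint (R : realType) (H : lmodType R[i])
    (dot : {dot H for Num.conj}) (V V' : {linear H -> H}) : Prop :=
  [/\ forall f g, dot (V f) g = dot f (V' g), cancel V V' & cancel V' V].

Definition unitarily_equivalent (R : realType) (H : lmodType R[i])
    (dot : {dot H for Num.conj}) (S T : operator H) : Prop :=
  exists V V' : {linear H -> H},
    [/\ unitary_with_adjoint dot V V',
        Dom S = V' @^-1` Dom T &
        forall f, Dom S f -> S f = V (T (V' f))].

Definition random_operator d (Omega : measurableType d) (R : realType)
    (H : normedModType R[i]) (X : Omega -> operator H) : Prop :=
  random_set (fun w => graph (X w)).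

Definition random_closed_operator d (Omega : measurableType d) (R : realType)
    (H : normedModType R[i]) (X : Omega -> operator H) : Prop :=
  random_operator X /\ forall w, closed_operator (X w).

Definition unitarily_invariant d (Omega : measurableType d) (R : realType)
    (P : {measure set Omega -> \bar R}) (H : lmodType R[i])
    (dot : {dot H for Num.conj}) (Tau : set (Omega -> Omega))
    (X : Omega -> operator H) : Prop :=
  forall tau, Tau tau ->
    \forall w \ae P, unitarily_equivalent dot (X (tau w)) (X w).

(* Main.v *)
From mathcomp Require Import finmap.
From HB Require Import structures.
From mathcomp Require Import all_boot all_order all_algebra.
From mathcomp Require Import all_classical all_reals all_analysis.
From mathcomp Require Import complex.
From mathcomp Require Import ring lra.
Require Import Defs.

(** Neither spectrum is reached through a measurable projection theorem.
    Every event in question is rewritten as a countable combination of events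
    of the form: the graph meets a fixed open set.  Three ideas make this
    possible.

    - Compactness.  The spectra are tested on closed squares of the plane.  If
      [O] is an open set of pairs (z, p) and K is compact, then the event that
      every z in K has some p in [Y w] with (z, p) in [O] is measurable for any
      random set [Y]: a finite subcover replaces the uncountable quantifier over
      z by one over finite families of basic squares
      ([measurable_forall_compact]).

    - Duality.  By Hahn-Banach in Hilbert space, here the projection theorem
      ([projection]), z is not an eigenvalue of a closed operator T exactly when
      the range of the adjoint relation of T minus the conjugate of z is dense
      ([eigenvaluesP]).  Density is a condition of the above open form, tested
      against a dense sequence.  The adjoint is an orthogonal complement, and
      the complement of a random closed subspace is again a random set: by
      Pythagoras, being close to the complement is the same as being far from
      the subspace ([random_ortho]).

    - The bounded inverse theorem.  The number z lies outside the spectrum of T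
      exactly when T - z is bounded below and has dense range ([spectrumP]).
      Dense range is again of the open form, and a bound from below holds
      uniformly on compact sets of z, so that its failure says that the graph
      meets certain open sets ([random_spectrum]).  The inverse of T - z is
      bounded because it has a closed graph ([closed_graph_bounded]); the proof
      is Banach's, by a Baire argument and successive approximation.

    For the second part, metric transitivity decides, for each square of a
    countable basis, whether the random set almost surely meets it or almost
    surely misses it.  The closure of a set is determined by the basic open sets
    that it meets, hence is almost surely constant
    ([random_set_closure_constant]).  Unitarily equivalent operators have the
    same spectra, and the spectrum of a closed operator is closed
    ([closed_spectrum]). *)

Set Implicit Arguments.
Unset Strict Implicit.
Unset Printing Implicit Defensive.

Import Order.TTheory GRing.Theory Num.Theory.
Import numFieldNormedType.Exports.

Local Open Scope classical_set_scope.
Local Open Scope ring_scope.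

(** * Norms with real values *)

Section rnorm.
Variables (R : realType) (E : normedModType R[i]).
Implicit Types (x y : E).

(** The norms at hand take values in [R[i]], which is only partially ordered;
    their real parts live in an ordered field. *)
Definition rnorm x : R := complex.Re `|x|.

Lemma rnormE x : `|x| = (rnorm x)%:C%C.
Proof. by rewrite /rnorm RRe_real // normr_real. Qed.

Lemma rnorm_ge0 x : 0 <= rnorm x.
Proof. by rewrite -ler0c -rnormE. Qed.

Lemma rnorm_eq0 x : (rnorm x == 0) = (x == 0).
Proof. by rewrite -[RHS]normr_eq0 rnormE -(inj_eq (@complexI R)). Qed.

Lemma rnorm0 : rnorm 0 = 0.
Proof. by apply/eqP; rewrite rnorm_eq0. Qed.

Lemma rnormN x : rnorm (- x) = rnorm x.
Proof. by rewrite /rnorm normrN. Qed.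

Lemma rnorm_sub x y : rnorm (x - y) = rnorm (y - x).
Proof. by rewrite /rnorm distrC. Qed.

Lemma rnormD x y : rnorm (x + y) <= rnorm x + rnorm y.
Proof. by rewrite -lecR rmorphD /= -!rnormE ler_normD. Qed.

Lemma rnormB_triangle z x y : rnorm (x - y) <= rnorm (x - z) + rnorm (z - y).
Proof. by rewrite -[x - y](subrKA z) rnormD. Qed.

Lemma nbhs_rnormP x (U : set E) :
  nbhs x U <-> exists2 e : R, 0 < e & forall y, rnorm (y - x) < e -> U y.
Proof.
split => [/nbhs_ballP[e /= e0 xU]|[e e0 xU]].
  have eR : (complex.Re e)%:C%C = e by rewrite RRe_real // realE ltW.
  exists (complex.Re e); first by rewrite -ltcR eR.
  by move=> y ye; apply: xU; rewrite -ball_normE /= rnormE -eR ltcR rnorm_sub.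
apply/nbhs_ballP; exists (e%:C)%C => /=; first by rewrite ltcR.
move=> y; rewrite -ball_normE /= rnormE ltcR rnorm_sub; exact: xU.
Qed.

Lemma open_rnorm_lt x (r : R) : open [set y | rnorm (y - x) < r].
Proof.
rewrite openE => y /= yr; apply/nbhs_rnormP; exists (r - rnorm (y - x)).
  by rewrite subr_gt0.
by move=> z zy /=; have := rnormB_triangle y z x; lra.
Qed.

Lemma cvg_rnormP (u : nat -> E) (l : E) :
  u @ \oo --> l <->
  forall e : R, 0 < e -> \forall n \near \oo, rnorm (u n - l) < e.
Proof.
split=> [ul e e0|ul A].
  have /ul : nbhs l [set y | rnorm (y - l) < e] by apply/nbhs_rnormP; exists e.
  by [].
move=> /nbhs_rnormP[e e0 lA]; apply: filterS (ul e e0) => n; exact: lA.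
Qed.

End rnorm.

Lemma rnormZ (R : realType) (E : normedModType R[i]) (a : R[i]) (x : E) :
  rnorm (a *: x) = rnorm (a : CC R) * rnorm x.
Proof. by apply: complexI; rewrite rmorphM /= -!rnormE normrZ. Qed.

Lemma rnormZ_real (R : realType) (E : normedModType R[i]) (a : R) (x : E) :
  rnorm ((a%:C)%C *: x) = `|a| * rnorm x.
Proof. 
rewrite rnormZ; congr (_ * _); rewrite /rnorm normc_def /= expr0n addr0.
by rewrite sqrtr_sqr.
Qed.

Lemma rnorm_cauchy (R : realType) (E : completeNormedModType R[i]) (u : nat -> E) :
  (forall e : R, 0 < e -> exists N, forall m n, (N <= m)%N -> (N <= n)%N ->
     rnorm (u m - u n) < e) -> exists l : E, u @ \oo --> l.
Proof.
move=> uC; suff /cauchy_cvg/cvg_ex[l ul] : cauchy (u @ \oo) by exists l.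
apply: cauchy_exP => e e0; have eR : (complex.Re e)%:C%C = e.
  by rewrite RRe_real // realE ltW.
have [|N uN] := uC (complex.Re e); first by rewrite -ltcR eR.
exists (u N), N => // n /= Nn.
by rewrite -ball_normE /= rnormE -eR ltcR; apply: uN.
Qed.

(** * Inner products *)

Section dot.
Variables (R : realType) (E : lmodType R[i]) (dot : {dot E for Num.conj}).

Definition nsq (p : E) : R := complex.Re (dot p p).

Lemma dot_ge0 p : 0 <= dot p p.
Proof.
have [->|p0] := eqVneq p 0; first by rewrite linear0l.
by rewrite ltW // neq0_dnorm_gt0.
Qed.

Lemma nsqE p : dot p p = ((nsq p)%:C)%C.
Proof. by rewrite /nsq RRe_real // realE dot_ge0. Qed.

Lemma nsq_ge0 p : 0 <= nsq p.
Proof. by rewrite -ler0c -nsqE dot_ge0. Qed.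

Lemma dotC p q : dot p q = (dot q p)^*%C.
Proof. by rewrite hermC /= expr0 mul1r. Qed.

End dot.

Section dot.
Variables (R : realType) (E : lmodType R[i]) (dot : {dot E for Num.conj}).
Implicit Types p q h : E.

(** The squared modulus, with values in [R]. *)
Definition sqc (a : R[i]) : R := complex.Re a ^+ 2 + complex.Im a ^+ 2.

Lemma sqc_ge0 a : 0 <= sqc a.
Proof. by rewrite addr_ge0 ?sqr_ge0. Qed.

Lemma sqc_eq0 a : sqc a = 0 -> a = 0.
Proof.
case: a => x y; rewrite /sqc /= => xy.
have [x0 y0] : x ^+ 2 = 0 /\ y ^+ 2 = 0.
  by have := sqr_ge0 x; have := sqr_ge0 y; split; lra.
by apply/eqP; rewrite eq_complex /= -(sqrf_eq0 x) -(sqrf_eq0 y) x0 y0 eqxx.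
Qed.

Lemma sqcD_le a b : sqc (a + b) <= 2 * sqc a + 2 * sqc b.
Proof.
case: a b => [a1 a2] [b1 b2]; rewrite /sqc /=.
by have := sqr_ge0 (a1 - b1); have := sqr_ge0 (a2 - b2); nra.
Qed.

Lemma dotDl p q h : dot (p + q) h = dot p h + dot q h.
Proof. exact: linearDl. Qed.

Lemma dotBl p q h : dot (p - q) h = dot p h - dot q h.
Proof. exact: linearBl. Qed.

Lemma dotBr p q h : dot h (p - q) = dot h p - dot h q.
Proof. exact: linearBr. Qed.

Lemma dotNr p q : dot p (- q) = - dot p q.
Proof. exact: linearNr. Qed.

Lemma dotZl a p q : dot (a *: p) q = a * dot p q.
Proof. exact: linearZl_LR. Qed.

Lemma dotZr a p q : dot p (a *: q) = a^*%C * dot p q.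
Proof. exact: linearZr_LR. Qed.

Lemma nsq_dotB p q : nsq dot (p - q) =
  nsq dot p - 2 * complex.Re (dot p q) + nsq dot q.
Proof.
rewrite /nsq dotBl !dotBr (dotC dot q p).
case: (dot p q) (dot p p) (dot q q) => [a1 a2] [b1 b2] [c1 c2] /=.
ring.
Qed.

Lemma nsqN p : nsq dot (- p) = nsq dot p.
Proof. by rewrite /nsq hnormN. Qed.

Lemma nsq_sub p q : nsq dot (p - q) = nsq dot (q - p).
Proof. by rewrite -nsqN opprB. Qed.

Lemma nsq_dotD p q : nsq dot (p + q) =
  nsq dot p + 2 * complex.Re (dot p q) + nsq dot q.
Proof.
rewrite -[q in LHS]opprK nsq_dotB nsqN dotNr raddfN /=; ring.
Qed.

Lemma nsq_parallelogram p q :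
  nsq dot (p + q) + nsq dot (p - q) = 2 * nsq dot p + 2 * nsq dot q.
Proof. rewrite nsq_dotD nsq_dotB; ring. Qed.

Lemma nsqD_le p q : nsq dot (p + q) <= 2 * nsq dot p + 2 * nsq dot q.
Proof. by have := nsq_parallelogram p q; have := nsq_ge0 dot (p - q); lra. Qed.

Lemma nsqZ a p : nsq dot (a *: p) = sqc a * nsq dot p.
Proof.
rewrite /nsq dotZl dotZr nsqE /sqc.
by case: a => x y /=; ring.
Qed.

Lemma nsq_eq0 p : nsq dot p = 0 -> p = 0.
Proof.
move=> p0; apply/eqP/negPn/negP => /(neq0_dnorm_gt0 (s := dot)).
by rewrite nsqE p0 ltxx.
Qed.

Lemma nsqD_ortho p q : dot p q = 0 -> nsq dot (p + q) = nsq dot p + nsq dot q.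
Proof. by move=> pq; rewrite nsq_dotD pq mulr0 addr0. Qed.

Lemma nsqB_ortho p q : dot p q = 0 -> nsq dot (p - q) = nsq dot p + nsq dot q.
Proof. by move=> pq; rewrite nsq_dotB pq mulr0 subr0. Qed.

(** The first order condition at an approximate minimum, with an explicit
    error.  For [eta := 0] it says that a shortest vector is orthogonal; for
    [eta := nsq dot p] it is a weak form of the Cauchy-Schwarz inequality. *)
Lemma dot_near_minimal p h (eta : R) :
  (forall a, nsq dot p - eta <= nsq dot (p - a *: h)) ->
  sqc (dot p h) <= (1 + nsq dot h) * eta.
Proof.
pose s := nsq dot h; have s0 : 0 <= s := nsq_ge0 dot h.
(* The best multiple is [dot p h / nsq dot h]; adding 1 to the denominator
   avoids the case [h = 0]. *)
pose t := (1 + s)^-1; have t0 : 0 < t by rewrite invr_gt0; lra.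
have ts : t * (1 + s) = 1 by rewrite mulVf //; apply: lt0r_neq0; lra.
set c := dot p h => /(_ ((t%:C)%C * c)).
rewrite nsq_dotB nsqZ -/s dotZr -/c.
have c0 := sqc_ge0 c.
have -> : complex.Re (((t%:C)%C * c)^*%C * c) = t * sqc c.
  by rewrite /sqc; case: c {c0} => x y /=; ring.
have -> : sqc ((t%:C)%C * c) = t ^+ 2 * sqc c.
  by rewrite /sqc; case: c {c0} => x y /=; ring.
move=> H.
have : t * (1 + t) * sqc c <= eta.
  have -> : t * (1 + t) = 2 * t - t ^+ 2 * s.
    have -> : t ^+ 2 * s = t * (t * (1 + s)) - t ^+ 2 by ring.
    by rewrite ts; ring.
  by lra.
move=> /(ler_wpM2l (ltW (_ : 0 < 1 + s))) => /(_ ltac:(lra)).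
rewrite 2!mulrA [_ * t]mulrC ts mul1r; have : 0 <= t * sqc c by nra.
lra.
Qed.

Lemma dot_bound p h : sqc (dot p h) <= (1 + nsq dot h) * nsq dot p.
Proof.
by apply: dot_near_minimal => a; rewrite subrr nsq_ge0.
Qed.

End dot.

Definition subspace (R : realType) (E : lmodType R[i]) (M : set E) :=
  M 0 /\ forall (a : R[i]) u v, M u -> M v -> M (a *: u + v).

Lemma subspaceB (R : realType) (E : lmodType R[i]) (M : set E) u v :
  subspace M -> M u -> M v -> M (u - v).
Proof.
by move=> [_ lM] Mu Mv; rewrite -scaleN1r addrC; apply: lM.
Qed.

Lemma subspaceZ (R : realType) (E : lmodType R[i]) (M : set E) (a : R[i]) u :
  subspace M -> M u -> M (a *: u).
Proof.
by move=> [M0 lM] Mu; rewrite -[_ *: _]addr0; apply: lM.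
Qed.

Definition ortho (R : realType) (E : lmodType R[i]) (dot : {dot E for Num.conj})
  (M : set E) : set E := [set p | forall m, M m -> dot p m = 0].

(** The norm of a product is a maximum and comes from no inner product, so
    only the topology and completeness are required to agree with [dot].  This
    covers both a Hilbert space and its square. *)
Definition hilbert_dot (R : realType) (E : normedModType R[i])
    (dot : {dot E for Num.conj}) :=
  (forall p (U : set E),
     nbhs p U <-> exists2 e : R, 0 < e & forall q, nsq dot (q - p) < e -> U q) /\
  (forall u : nat -> E,
     (forall e : R, 0 < e -> exists N, forall m n, (N <= m)%N -> (N <= n)%N ->
        nsq dot (u m - u n) < e) -> exists l : E, u @ \oo --> l).

Lemma exists_invS_lt (R : realType) (e : R) : 0 < e -> exists n, n.+1%:R^-1 < e.
Proof.
by move=> e0; have [N] := ltr_add_invr e0; rewrite add0r => Ne; exists N.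
Qed.

(** * The projection theorem *)

Section projection.
Variables (R : realType) (E : normedModType R[i]) (dot : {dot E for Num.conj}).
Hypothesis hdot : hilbert_dot dot.
Implicit Types (M G : set E).

Lemma nsq_cvg (u : nat -> E) l (e : R) : u @ \oo --> l -> 0 < e ->
  \forall n \near \oo, nsq dot (u n - l) < e.
Proof.
move=> ul e0; have /ul : nbhs l [set q | nsq dot (q - l) < e].
  by apply/hdot.1; exists e.
by [].
Qed.

(** A minimizing sequence for the distance from [p] to [M] is Cauchy by the
    parallelogram identity.  The subspace need not be closed; this is why the
    foot of the perpendicular is only found in the closure. *)
Lemma projection M p : subspace M ->
  exists2 l, closure M l & ortho dot M (p - l).
Proof.
move=> sM; pose A := [set nsq dot (p - m) | m in M].
have A0 : A !=set0 by exists (nsq dot (p - 0)), 0 => //; exact: sM.1.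
have Alb : lbound A 0 by move=> _ [m _ <-]; exact: nsq_ge0.
have iA : has_inf A by split=> //; exists 0.
have infA m : M m -> inf A <= nsq dot (p - m).
  by move=> Mm; apply: ge_inf; [exists 0|exists m].
have /choice[m mP] n : exists m, M m /\ nsq dot (p - m) < inf A + n.+1%:R^-1.
  have [//|_ [m Mm <-] mA] := @inf_adherent _ A n.+1%:R^-1 _ iA.
  by exists m.
have [l ml] : exists l : E, m @ \oo --> l.
  apply: hdot.2 => e e0; have [|N Ne] := @exists_invS_lt _ (e / 4); first by lra.
  exists N => a b Na Nb.
  have inv_le k : (N <= k)%N -> k.+1%:R^-1 <= N.+1%:R^-1 :> R.
    by move=> Nk; rewrite lef_pV2 ?posrE // ler_nat ltnS.
  have [Ma ma] := mP a; have [Mb mb] := mP b.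
  (* The midpoint of [m a] and [m b] is in [M], hence no closer to [p] than the
     infimum. *)
  have := nsq_parallelogram dot (p - m a) (p - m b).
  have -> : p - m a - (p - m b) = m b - m a by rewrite opprB addrC subrKA.
  have -> : p - m a + (p - m b) =
      2 *: (p - (2^-1 *: m a + 2^-1 *: m b)).
    rewrite scalerBr scalerDr !scalerA divff ?pnatr_eq0 // !scale1r.
    by rewrite scaler_nat mulr2n addrACA -opprD.
  rewrite nsqZ (nsq_sub _ (m b)).
  have -> : sqc (2 : R[i]) = 4 by rewrite /sqc /=; ring.
  have := infA _ (sM.2 2^-1 _ _ Ma (subspaceZ 2^-1 sM Mb)).
  move: (inv_le _ Na) (inv_le _ Nb) ma mb Ne.
  by move: (a.+1%:R^-1) (b.+1%:R^-1) (N.+1%:R^-1) => x y z; lra.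
exists l.
  move=> U /ml [N _ NU]; exists (m N); split; first exact: (mP N).1.
  by apply: NU => /=.
move=> h Mh; apply: sqc_eq0; apply/eqP/negPn/negP => c0.
pose e := sqc (dot (p - l) h); have e0 : 0 < e by rewrite lt0r c0 sqc_ge0.
pose s := nsq dot h; have s0 : 0 <= s := nsq_ge0 dot h.
pose r := e / (8 * (1 + s)); have r0 : 0 < r by rewrite divr_gt0 //; lra.
have rs : (1 + s) * r = e / 8.
  by rewrite /r; field; apply: lt0r_neq0; lra.
near \oo => n.
have ln : nsq dot (m n - l) < r by near: n; exact: nsq_cvg.
have rn : n.+1%:R^-1 < r by near: n; exact: near_infty_natSinv_lt (PosNum r0).
have [Mn mn] := mP n.
have : sqc (dot (p - m n) h) <= (1 + s) * n.+1%:R^-1.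
  apply: dot_near_minimal => a.
  rewrite -addrA -opprD (addrC (m n)).
  by have := infA _ (sM.2 a _ _ Mh Mn); move: mn; move: (n.+1%:R^-1) => x; lra.
have := dot_bound dot (m n - l) h; rewrite -/s.
have := sqcD_le (dot (p - m n) h) (dot (m n - l) h).
rewrite -dotDl subrKA -/e; move: rn; move: (n.+1%:R^-1) => x rn.
nra.
Unshelve. all: by end_near. Qed.

(** The part of [p] orthogonal to [G] is orthogonal both to [p] and to its own
    projection, hence to itself. *)
Lemma ortho_ortho G : subspace G -> closed G -> ortho dot (ortho dot G) `<=` G.
Proof.
move=> sG cG p pG; have [l /cG Gl plG] := projection p sG.
suff /subr0_eq -> : p - l = 0 by [].
apply: (@nsq_eq0 _ _ dot).
by rewrite /nsq dotBl pG // (dotC _ l) plG // conjc0 subrr.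
Qed.

Lemma dense_subspaceP M : subspace M ->
  closure M = setT <-> forall y, ortho dot M y -> y = 0.
Proof.
move=> sM; split=> [MT y yM|M0].
  have : closure M y by rewrite MT.
  move=> /(_ [set q | nsq dot (q - y) < nsq dot y]) clM.
  apply: (@nsq_eq0 _ _ dot); apply/eqP/negPn/negP => y0.
  have : [set q | nsq dot (q - y) < nsq dot y] `&` M !=set0.
    rewrite setIC; apply: clM; apply/hdot.1; exists (nsq dot y) => //.
    by rewrite lt0r y0 nsq_ge0.
  move=> [m [/= + Mm]]; rewrite nsq_sub nsqB_ortho ?yM //.
  by have := nsq_ge0 dot m; lra.
rewrite -subTset => p _; have [l Ml /M0 /subr0_eq -> //] := projection p sM.
Qed.

End projection.

(** Young's inequality; a small weight [t] on [q] yields the continuity of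
    [nsq] without square roots. *)
(** * Orthogonal complements of random subspaces *)

Lemma nsqD_weighted (R : realType) (E : lmodType R[i]) (dot : {dot E for Num.conj})
    (t : R) (p q : E) : 0 < t ->
  nsq dot (p + q) <= (1 + t^-1) * nsq dot p + (1 + t) * nsq dot q.
Proof.
move=> t0; have := nsq_ge0 dot (p - (t%:C)%C *: q).
rewrite nsq_dotB nsqZ dotZr nsq_dotD.

have -> : sqc (t%:C)%C = t ^+ 2 by rewrite /sqc /=; ring.
have -> : complex.Re ((t%:C)^*%C * dot p q)%C = t * complex.Re (dot p q).
  by case: (dot p q) => a b /=; ring.
move=> H; have := mulr_ge0 (ltW (_ : 0 < t^-1)) H; rewrite invr_gt0 => /(_ t0).
have tV : t^-1 * t = 1 by rewrite mulVf // gt_eqF.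
move: (nsq dot p) (nsq dot q) (complex.Re _) t^-1 tV {H} => a b c v tV.
have -> : v * (a - 2 * (t * c) + t ^+ 2 * b) =
  v * a - 2 * (v * t) * c + (v * t) * t * b by ring.
rewrite tV; lra.
Qed.

Section random_ortho.
Variables (R : realType) (E : normedModType R[i]) (dot : {dot E for Num.conj}).
Hypothesis hdot : hilbert_dot dot.

Lemma open_nsq_lt p (r : R) : open [set q | nsq dot (p - q) < r].
Proof.
rewrite openE => q /= qr; apply/(hdot.1 q).
pose s := nsq dot (p - q); have s0 : 0 <= s := nsq_ge0 _ _.
pose t := (r - s) / (2 * (1 + s)).
have t0 : 0 < t by rewrite divr_gt0 //; rewrite /s; lra.
have ts : t * (2 * (1 + s)) = r - s by rewrite divfK //; apply: lt0r_neq0; lra.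
have V0 : 0 < 1 + t^-1 by rewrite addr_gt0 // invr_gt0.
exists ((r - s) / 2 / (1 + t^-1)); first by rewrite divr_gt0 // /s; lra.
move=> q' /=; rewrite ltr_pdivlMr // nsq_sub => qq'.
have := nsqD_weighted dot (q - q') (p - q) t0; rewrite addrC subrKA -/s.
rewrite -/s in qr; nra.
Qed.

Variables (d : measure_display) (Omega : measurableType d).
Variables (I : countType) (D : I -> E).
Hypothesis D_dense : forall p (e : R), 0 < e -> exists i, nsq dot (D i - p) < e.

(** The distance from [p] to the complement of [G] is the length of the
    projection of [p] on [G], and its square is the difference of [nsq dot p]
    and the squared distance to [G].  Being close to the complement therefore
    means not being close to [G]. *)
Lemma ortho_meets_ballP (G : set E) p (r : R) : subspace G -> closed G ->
  (exists2 q, ortho dot G q & nsq dot (q - p) < r) <->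
  ~ forall k : nat, exists2 g, G g & nsq dot (p - g) < nsq dot p - r + k.+1%:R^-1.
Proof.
move=> sG cG; have [l /cG Gl opl] := projection hdot p sG.
have pl m : G m -> nsq dot (p - m) = nsq dot (p - l) + nsq dot (l - m).
  by move=> Gm; rewrite -nsqD_ortho ?subrKA //; apply: opl; apply: subspaceB.
have pE : nsq dot p = nsq dot (p - l) + nsq dot l.
  by have := pl 0 sG.1; rewrite !subr0.
split=> [[q oq qr] H|].
  suff : r <= nsq dot l.
    apply/negP; rewrite -ltNge; apply: le_lt_trans qr.
    have -> : q - p = (q - (p - l)) - l by rewrite opprB addrA addrAC addrK.
    rewrite nsqB_ortho; first by have := nsq_ge0 dot (q - (p - l)); lra.
    by rewrite dotBl (oq _ Gl) (opl _ Gl) subrr.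
  rewrite leNgt; apply/negP => lr.
  have [|k] := @exists_invS_lt _ (r - nsq dot l); first by lra.
  have [g Gg] := H k; rewrite pl // pE; have := nsq_ge0 dot (l - g).
  by move: (k.+1%:R^-1) => x; lra.
move=> H; exists (p - l) => //; rewrite addrAC subrr add0r nsqN ltNge.
apply/negP => rl; apply: H => k; exists l => //.
rewrite pE; have : (0 : R) < k.+1%:R^-1 by [].
by move: (k.+1%:R^-1) => x; lra.
Qed.

(** Every open set is a countable union of balls around a dense family, and
    [ortho_meets_ballP] turns the event that the complement meets a ball into
    the negation of countably many events that [G] meets one. *)
Lemma random_ortho (G : Omega -> set E) :
  (forall w, subspace (G w)) -> (forall w, closed (G w)) ->
  random_set G -> random_set (fun w => ortho dot (G w)).
Proof.
move=> sG cG rG U oU.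
pose B i n := [set q | nsq dot (D i - q) < n.+1%:R^-1].
pose A (x : I * nat) := [set w | B x.1 x.2 `<=` U /\
  exists2 q, ortho dot (G w) q & nsq dot (q - D x.1) < x.2.+1%:R^-1].
have -> : [set w | ortho dot (G w) `&` U !=set0] = \bigcup_x A x.
  apply/seteqP; split=> [w [q [oq Uq]]|w [[i n] _ [/= BU [q oq qi]]]]; last first.
    by exists q; split=> //; apply: BU; rewrite /B /= nsq_sub.
  have [e e0 qU] : exists2 e : R, 0 < e & forall p, nsq dot (p - q) < e -> U p.
    by apply/(hdot.1 q); exact: open_nbhs_nbhs.
  have [|n ne] := @exists_invS_lt _ (e / 4); first by lra.
  have [i qi] := @D_dense q n.+1%:R^-1 (ltac:(by [])).
  exists (i, n) => //; split=> /=; last by exists q; rewrite // nsq_sub.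
  move=> p /=; rewrite /B /= => pi; apply: qU.
  rewrite -(subrKA (D i)).
  have := nsqD_le dot (p - D i) (D i - q); rewrite nsq_sub in pi.
  by move: ne qi pi; move: (n.+1%:R^-1) => x; lra.
apply: countable_bigcupT_measurable => [|[i n]]; first exact: countableP.
have [BU|nBU] := pselect (B i n `<=` U); last first.
  rewrite (_ : A _ = set0); first exact: measurable0.
  by apply/seteqP; split=> // w [].
pose C k := [set w | G w `&` [set g | nsq dot (D i - g) <
   nsq dot (D i) - n.+1%:R^-1 + k.+1%:R^-1] !=set0].
have -> : A (i, n) = ~` \bigcap_k C k.
  apply/seteqP; split=> [w [_ /= /ortho_meets_ballP]|w /= nC].
    move=> /(_ (sG w) (cG w)) H CC; apply: H => k; have [g [Gg gk]] := CC k Logic.I.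
    by exists g.
  split=> //; apply/ortho_meets_ballP => // H; apply: nC => k _.
  by have [g Gg gk] := H k; exists g.
apply: measurableC; apply: bigcapT_measurable => k.
by apply: rG; exact: open_nsq_lt.
Qed.

End random_ortho.

(** * The Hilbert space of pairs *)

Section pair_form.
Variables (R : realType) (H : lmodType R[i]) (dot : {dot H for Num.conj}).

Definition pair_form (p q : H * H) : R[i] := dot p.1 q.1 + dot p.2 q.2.

Lemma pair_form_zmodl q : zmod_morphism (pair_form ^~ q).
Proof. by move=> x y; rewrite /pair_form /= !dotBl opprD addrACA. Qed.

Lemma pair_form_zmodr p : zmod_morphism (pair_form p).
Proof. by move=> x y; rewrite /pair_form /= !dotBr opprD addrACA. Qed.

Lemma pair_form_scalel q : scalable_for *%R (pair_form ^~ q).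
Proof. by move=> a x; rewrite /pair_form /= !dotZl mulrDr. Qed.

Lemma pair_form_scaler p : scalable_for (Num.conj \; *%R) (pair_form p).
Proof. by move=> a x; rewrite /pair_form /= !dotZr mulrDr. Qed.

HB.instance Definition _ := isBilinear.Build _ _ _ _ _ _ pair_form
  pair_form_zmodl pair_form_zmodr pair_form_scalel pair_form_scaler.

Lemma pair_form_hermitian x y : pair_form x y = (-1) ^+ false * (pair_form y x)^*%C.
Proof.
by rewrite /pair_form expr0 mul1r rmorphD /= (dotC dot y.1) (dotC dot y.2) !conjcK.
Qed.

HB.instance Definition _ := isHermitianSesquilinear.Build _ _ _ _ pair_form
  pair_form_hermitian.

Lemma pair_form_gt0 p : p != 0 -> 0 < pair_form p p.
Proof.
case: p => f h; rewrite /pair_form /=; have [->|f0 _] := eqVneq f 0.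
  rewrite xpair_eqE eqxx /= => h0.
  by rewrite ltr_wpDl ?dot_ge0 // neq0_dnorm_gt0.
by rewrite ltr_wpDr ?dot_ge0 // neq0_dnorm_gt0.
Qed.

HB.instance Definition _ := isDotProduct.Build _ _ pair_form pair_form_gt0.

Definition pair_dot : {dot (H * H)%type for Num.conj} := pair_form.

Lemma nsq_pair p : nsq pair_dot p = nsq dot p.1 + nsq dot p.2.
Proof. by rewrite /nsq -raddfD. Qed.

End pair_form.

Section hilbert.
Variables (R : realType) (H : completeNormedModType R[i]).
Variables (dot : {dot H for Num.conj}) (dot_norm : induces_norm dot).

Lemma nsq_rnorm f : nsq dot f = rnorm f ^+ 2.
Proof.
by apply: complexI; rewrite -nsqE -dot_norm rnormE rmorphXn.
Qed.

Lemma nsq_lt f (e : R) : 0 < e -> (nsq dot f < e ^+ 2) = (rnorm f < e).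
Proof.
by move=> e0; rewrite nsq_rnorm ltr_pXn2r // ?nnegrE ?rnorm_ge0 // ltW.
Qed.

Lemma hilbert_dot_induced : hilbert_dot dot.
Proof.
split=> [p U|u uC].
  rewrite nbhs_rnormP; split=> -[e e0 pU].
    by exists (e ^+ 2) => [|q]; [exact: exprn_gt0|rewrite nsq_lt //; exact: pU].
  exists (Num.sqrt e) => [|q]; first by rewrite sqrtr_gt0.
  by rewrite -nsq_lt ?sqrtr_gt0 // sqr_sqrtr ?ltW //; exact: pU.
apply: rnorm_cauchy => e e0; have [N uN] := uC _ (exprn_gt0 2 e0).
by exists N => m n Nm Nn; rewrite -nsq_lt // uN.
Qed.

Lemma hilbert_dot_pair : hilbert_dot (pair_dot dot).
Proof.
have hH := hilbert_dot_induced.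
have fst_le p : nsq dot p.1 <= nsq (pair_dot dot) p.
  by rewrite nsq_pair lerDl nsq_ge0.
have snd_le p : nsq dot p.2 <= nsq (pair_dot dot) p.
  by rewrite nsq_pair lerDr nsq_ge0.
split=> [p U|u uC].
  split=> [[[A B] [/= /(hH.1 p.1)[a a0 pA] /(hH.1 p.2)[b b0 pB]] ABU]|].
    exists (Num.min a b) => [|q]; first by rewrite lt_min a0.
    rewrite lt_min => /andP[qa qb]; apply: ABU; split=> /=.
      by apply: pA; apply: le_lt_trans qa; exact: (fst_le (q - p)).
    by apply: pB; apply: le_lt_trans qb; exact: (snd_le (q - p)).
  move=> [e e0 pU]; have e20 : 0 < e / 2 by lra.
  exists ([set q | nsq dot (q - p.1) < e / 2], [set q | nsq dot (q - p.2) < e / 2]).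
    by split=> /=; [apply/(hH.1 p.1)|apply/(hH.1 p.2)]; exists (e / 2).
  move=> q [/= q1 q2]; apply: pU; rewrite nsq_pair /=; lra.
have [l1 ul1] : exists l : H, (fun n => (u n).1) @ \oo --> l.
  apply: hH.2 => e /uC[N uN]; exists N => m n Nm Nn.
  by apply: le_lt_trans (uN _ _ Nm Nn); exact: (fst_le (u m - u n)).
have [l2 ul2] : exists l : H, (fun n => (u n).2) @ \oo --> l.
  apply: hH.2 => e /uC[N uN]; exists N => m n Nm Nn.
  by apply: le_lt_trans (uN _ _ Nm Nn); exact: (snd_le (u m - u n)).
exists (l1, l2).
have -> : u = (fun n => ((u n).1, (u n).2)) by apply/funext => n; case: (u n).
exact: cvg_pair.
Qed.

Hypothesis H_separable : separable H.

Lemma separable_sequence : exists D : nat -> H,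
  forall p (e : R), 0 < e -> exists n, rnorm (D n - p) < e.
Proof.
have [D cD dD] := H_separable.
have /countable_injP[f f_inj] := cD.
pose g n := xget 0 [set q | D q /\ f q = n].
exists g => p e e0.
have [q [qe Dq]] : [set q | rnorm (q - p) < e] `&` D !=set0.
  apply: dD; last exact: open_rnorm_lt.
  by exists p => /=; rewrite subrr rnorm0.
exists (f q); suff -> : g (f q) = q by [].
by rewrite /g; case: xgetP => [x _ [Dx /f_inj -> //]|/(_ q) []//]; rewrite inE.
Qed.

Lemma pair_dot_dense (D : nat -> H) :
  (forall p (e : R), 0 < e -> exists n, rnorm (D n - p) < e) ->
  forall p (e : R), 0 < e ->
  exists i : nat * nat, nsq (pair_dot dot) ((D i.1, D i.2) - p) < e.
Proof.
move=> DD p e e0; have r0 : 0 < Num.sqrt (e / 2) by rewrite sqrtr_gt0; lra.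
have [[m mp] [n np]] := (DD p.1 _ r0, DD p.2 _ r0).
exists (m, n); rewrite nsq_pair /=.
rewrite -nsq_lt // sqr_sqrtr in mp; last by lra.
rewrite -nsq_lt // sqr_sqrtr in np; last by lra.
lra.
Qed.

End hilbert.

(** * Random sets in the complex plane *)

Section plane.
Variable R : realType.
Implicit Types (z : CC R) (i : rat * rat * nat).

Lemma rnorm_sq z : rnorm z ^+ 2 = complex.Re z ^+ 2 + complex.Im z ^+ 2.
Proof.
by rewrite /rnorm normc_def /= sqr_sqrtr // addr_ge0 ?sqr_ge0.
Qed.

Lemma Re_le_rnorm z : `|complex.Re z| <= rnorm z.
Proof.
rewrite -(@ler_pXn2r _ 2) ?nnegrE ?rnorm_ge0 // rnorm_sq real_normK ?num_real //.
by rewrite lerDl sqr_ge0.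
Qed.

Lemma Im_le_rnorm z : `|complex.Im z| <= rnorm z.
Proof.
rewrite -(@ler_pXn2r _ 2) ?nnegrE ?rnorm_ge0 // rnorm_sq real_normK ?num_real //.
by rewrite lerDr sqr_ge0.
Qed.

Lemma rnorm_le_ReIm z : rnorm z <= `|complex.Re z| + `|complex.Im z|.
Proof.
have h : 0 <= `|complex.Re z| + `|complex.Im z| by rewrite addr_ge0.
rewrite -(@ler_pXn2r _ 2) ?nnegrE ?rnorm_ge0 // rnorm_sq sqrrD.
rewrite !real_normK ?num_real // lerD2r lerDl.
by rewrite mulrn_wge0 // mulr_ge0.
Qed.

Lemma rnorm_conj z : rnorm (z^*%C : CC R) = rnorm z.
Proof. by rewrite /rnorm normcJ. Qed.

(** The open squares are a countable basis of the plane.  The closed ones are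
    compact, and every open set is a union of countably many of them. *)
Definition osquare i : set (CC R) := [set z |
  `|complex.Re z - ratr i.1.1| < i.2.+1%:R^-1 /\
  `|complex.Im z - ratr i.1.2| < i.2.+1%:R^-1].

Definition csquare i : set (CC R) := [set z |
  `|complex.Re z - ratr i.1.1| <= i.2.+1%:R^-1 /\
  `|complex.Im z - ratr i.1.2| <= i.2.+1%:R^-1].

Lemma open_osquare i : open (osquare i).
Proof.
rewrite openE => z [/= zr zi]; apply/nbhs_rnormP.
exists (Num.min (i.2.+1%:R^-1 - `|complex.Re z - ratr i.1.1|)
           (i.2.+1%:R^-1 - `|complex.Im z - ratr i.1.2|)).
  by rewrite lt_min !subr_gt0 zr zi.
move=> y; rewrite lt_min => /andP[yr yi]; split=> /=.
  apply: le_lt_trans (ler_distD (complex.Re z) _ _) _.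
  rewrite -ltrBrDr; apply: le_lt_trans yr.
  by rewrite -raddfB; exact: Re_le_rnorm.
apply: le_lt_trans (ler_distD (complex.Im z) _ _) _.
rewrite -ltrBrDr; apply: le_lt_trans yi.
by rewrite -raddfB; exact: Im_le_rnorm.
Qed.

Lemma compact_csquare i : compact (csquare i).
Proof.
pose f (p : R * R) : CC R := (p.1 +i* p.2)%C.
have cf : continuous f.
  move=> p A /nbhs_rnormP[e e0 pA].
  have e20 : 0 < e / 2 by lra.
  exists (ball p.1 (e / 2), ball p.2 (e / 2)).
    by split; exact: nbhsx_ballx.
  move=> [x y] [/= xe ye]; apply: pA.
  apply: le_lt_trans (rnorm_le_ReIm _) _ => /=.
  by move: xe ye; rewrite -!ball_normE /= => xe ye; rewrite distrC (distrC y); lra.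
pose r : R := i.2.+1%:R^-1.
have -> : csquare i = f @` (`[ratr i.1.1 - r, ratr i.1.1 + r] `*`
                            `[ratr i.1.2 - r, ratr i.1.2 + r]).
  apply/seteqP; split=> [[x y] [/= xi yi]|_ [[x y] [/= xi yi] <-]].
    by exists (x, y) => //; split; rewrite /= in_itv /= -ler_distl.
  by split=> /=; rewrite ler_distl -/r; rewrite !in_itv /= in xi yi.
apply: continuous_compact; first exact: continuous_subspaceT.
by apply: compact_setX; exact: segment_compact.
Qed.

Lemma square_basis (U : set (CC R)) z : open U -> U z ->
  exists i, osquare i z /\ csquare i `<=` U.
Proof.
move=> oU Uz; have /nbhs_rnormP[e e0 zU] : nbhs z U by exact: open_nbhs_nbhs.
have [|n ne] := @exists_invS_lt _ (e / 4); first by lra.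
have n0 : (0 : R) < n.+1%:R^-1 by [].
pose r : R := n.+1%:R^-1.
have near_rat (x : R) : exists q : rat, `|x - ratr q| < r.
  have [|q] := @rat_in_itvoo _ (x - r) (x + r).
    by move: n0; rewrite -/r; move: (r) => s s0; lra.
  by rewrite in_itv /= -ltr_distl distrC; exists q.
have [[a az] [b bz]] := (near_rat (complex.Re z), near_rat (complex.Im z)).
exists (a, b, n); split=> // y [/= ya yb]; apply: zU.
apply: le_lt_trans (rnorm_le_ReIm _) _.
rewrite !raddfB /=; move: ya yb ne az bz; rewrite -/r; move: (r) => s ya yb ne az bz.
have := ler_distD (ratr a) (complex.Re y) (complex.Re z).
have := ler_distD (ratr b) (complex.Im y) (complex.Im z).
rewrite (distrC (ratr a)) (distrC (ratr b)); lra.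
Qed.

Lemma osquare_sub i : osquare i `<=` csquare i.
Proof. by move=> z [? ?]; split; exact: ltW. Qed.

Section measurability.
Variables (d : measure_display) (Omega : measurableType d).

Lemma random_set_csquare (Y : Omega -> set (CC R)) :
  (forall i, measurable [set w | Y w `&` csquare i !=set0]) -> random_set Y.
Proof.
move=> mY U oU.
have -> : [set w | Y w `&` U !=set0] =
    \bigcup_i [set w | csquare i `<=` U /\ Y w `&` csquare i !=set0].
  apply/seteqP; split=> [w [z [Yz Uz]]|w [i _ [iU [z [Yz /iU Uz]]]]].
    have [i [/osquare_sub iz iU]] := square_basis oU Uz.
    by exists i => //; split=> //; exists z.
  by exists z.
apply: countable_bigcupT_measurable => [|i]; first exact: countableP.
have [iU|niU] := pselect (csquare i `<=` U).
  rewrite (_ : mkset _ = [set w | Y w `&` csquare i !=set0]) //.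
  by apply/seteqP; split=> w // [].
rewrite (_ : mkset _ = set0); first exact: measurable0.
by apply/seteqP; split=> // w [].
Qed.

(** Let [W i] consist of the [p] near which the whole square [osquare i] stays
    in [O].  The condition holds on [K] exactly when [Y w] meets [W i] for all
    squares of some finite cover of [K], and finite covers by basic squares are
    countably many. *)
Lemma measurable_forall_compact (S : topologicalType) (Y : Omega -> set S)
    (O : set (CC R * S)) (K : set (CC R)) :
  random_set Y -> open O -> compact K ->
  measurable [set w | forall z, K z -> exists2 p, Y w p & O (z, p)].
Proof.
move=> rY oO cK.
pose W i := \bigcup_(V in [set V : set S | open V /\ osquare i `*` V `<=` O]) V.
have oW i : open (W i) by apply: bigcup_open => V [].
pose T := {fset (rat * rat * nat)%type}.
pose M i := [set w | Y w `&` W i !=set0].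
have -> : [set w | forall z, K z -> exists2 p, Y w p & O (z, p)] =
    \bigcup_(s : T) [set w | K `<=` cover [set` s] osquare /\
                            (\bigcap_(i in [set` s]) M i) w].
  apply/seteqP; split=> [w YO|w [s _ [Ks Ms]] z /Ks[i si iz]]; last first.
    by have [p [Yp [V [oV iV] Vp]]] := Ms i si; exists p => //; apply: iV.
  move: cK; rewrite compact_cover => cK.
  have [|z Kz|s sM Ks] := cK _ [set i | M i w] osquare.
  - by move=> i _; exact: open_osquare.
  - have [p Yp Ozp] := YO z Kz.
    have [[A B] [/= Az Bp] ABO] : nbhs (z, p) O by exact: open_nbhs_nbhs.
    have [A' [oA' A'z] A'A] : exists2 A', open_nbhs z A' & A' `<=` A.
      by move: Az; rewrite nbhsE.
    have [B' [oB' B'p] B'B] : exists2 B', open_nbhs p B' & B' `<=` B.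
      by move: Bp; rewrite nbhsE.
    have [i [iz iA]] := square_basis oA' A'z.
    exists i => //; exists p; split=> //; exists B' => //.
    split=> // -[y q] [/= yi Bq].
    by apply: ABO; split=> /=; [apply/A'A/iA/osquare_sub|exact: B'B].
  - by exists s => //; split=> // i si; exact: set_mem (sM i si).
apply: countable_bigcupT_measurable => [|s]; first exact: countableP.
have [Ks|nKs] := pselect (K `<=` cover [set` s] osquare).
  rewrite (_ : mkset _ = \bigcap_(i in [set` s]) M i).
    by apply: fin_bigcap_measurable => // i _; exact: rY.
  by apply/seteqP; split=> w // [].
rewrite (_ : mkset _ = set0); first exact: measurable0.
by apply/seteqP; split=> // w [].
Qed.

(** A zero-one law: each of the countably many basic squares is met almost
    surely or missed almost surely, and the closure of a set is the complement
    of the union of the basic squares that it misses. *)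
Lemma random_set_closure_constant (P : {measure set Omega -> \bar R})
    (Tau : set (Omega -> Omega)) (Y : Omega -> set (CC R)) :
  (forall tau, Tau tau -> measurable_fun [set: Omega] tau) ->
  metrically_transitive P Tau -> random_set Y ->
  (forall tau, Tau tau -> \forall w \ae P, Y (tau w) = Y w) ->
  exists2 F, closed F & \forall w \ae P, closure (Y w) = F.
Proof.
move=> mTau tTau rY YTau.
pose A i := [set w | Y w `&` osquare i !=set0].
have mA i : measurable (A i) by apply: rY; exact: open_osquare.
have A01 i : P (A i) = 0%E \/ P (~` A i) = 0%E.
  apply: tTau => // tau Ttau; have [N [mN N0 YN]] := YTau tau Ttau.
  apply: (@subset_measure0 _ _ _ P _ N) => //.
    apply: measurableU; apply: measurableD => //.
      by rewrite -[_ @^-1` _]setTI; exact: mTau.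
    by rewrite -[_ @^-1` _]setTI; exact: mTau.
  by move=> w wA; apply: YN => /= Yw; move: wA; rewrite /A /setY /= Yw; case; case.
exists (\bigcap_(i in [set i | P (A i) = 0%E]) ~` osquare i).
  by apply: closed_bigI => i _; exact/open_closedC/open_osquare.
have A_ae i : \forall w \ae P, A i w <-> P (A i) <> 0%E.
  have [Ai0|/[dup] nAi0 Ai1] := pselect (P (A i) = 0%E).
    by exists (A i); split=> // w /= wA; apply: contrapT => nAw; apply: wA.
  have [//|Ai0] := A01 i.
  exists (~` A i); split=> //; first exact: measurableC.
  by move=> w /= wA Aw; apply: wA.
have : \forall w \ae P, forall n,
    if @unpickle (rat * rat * nat)%type n is Some i
    then A i w <-> P (A i) <> 0%E else True.
  apply: ae_foralln => n; case: unpickle => [i|]; first exact: A_ae.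
  exact: aeW.
apply: filterS => w Aw.
have {}Aw i : A i w <-> P (A i) <> 0%E.
  by have := Aw (pickle i); rewrite pickleK.
apply/seteqP; split=> [z Yz i /= Ai0 iz|z zF B].
  have [y [Yy iy]] : Y w `&` osquare i !=set0.
    by apply: Yz; apply: open_nbhs_nbhs; split=> //; exact: open_osquare.
  by have /Aw/(_ Ai0) : A i w by exists y.
rewrite nbhsE => -[U [oU Uz] UB].
have [i [iz iU]] := square_basis oU Uz.
have /Aw[y [Yy iy]] : P (A i) <> 0%E by move=> /zF; apply.
by exists y; split=> //; apply/UB/iU/osquare_sub.
Qed.

End measurability.
End plane.

(** * Eigenvalues *)

Section operators.
Variables (R : realType) (H : lmodType R[i]).
Implicit Types T : operator H.

Lemma Dom_lin T (a : R[i]) f g : Dom T f -> Dom T g -> Dom T (a *: f + g).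
Proof.
move=> Tf Tg; have [_ lT] := Dom_submod T.
by apply/set_mem/lT; exact/mem_set.
Qed.

Lemma Dom0 T : Dom T 0.
Proof. by have [/set_mem D0 _] := Dom_submod T. Qed.

Lemma oper0 T : T 0 = 0.
Proof.
have := oper_linear 1 (Dom0 T) (Dom0 T); rewrite !scale1r addr0 => /eqP.
by rewrite addrC -subr_eq subrr eq_sym => /eqP.
Qed.

Lemma graphP T f h : graph T (f, h) <-> Dom T f /\ h = T f.
Proof.
by split=> [[g Tg [<- <-]]|[Tf ->]]; [split|exists f].
Qed.

Lemma subspace_graph T : subspace (graph T).
Proof.
split; first by apply/graphP; split; [exact: Dom0|rewrite oper0].
move=> a [f h] [f' h'] /graphP[Tf ->] /graphP[Tf' ->].
by apply/graphP; split; [exact: Dom_lin|rewrite oper_linear].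
Qed.

Definition shifted_range T (z : R[i]) : set H :=
  [set p.2 - z *: p.1 | p in graph T].

Lemma subspace_shifted_range T z : subspace (shifted_range T z).
Proof.
split; first by exists 0; [exact: (subspace_graph T).1|rewrite /= scaler0 subrr].
move=> a _ _ [p Tp <-] [q Tq <-]; exists (a *: p + q).
  exact: (subspace_graph T).2.
by rewrite /= scalerDr scalerBr opprD addrACA !scalerA mulrC.
Qed.

(** A pair (u, v) is orthogonal to the graph of [T] exactly when (v, - u) lies
    in the graph of the adjoint, so this is the range of the adjoint minus
    [z^*].  The adjoint is a multivalued relation, as [T] may fail to be densely
    defined. *)
Definition adjoint_range (dot : {dot H for Num.conj}) T (z : R[i]) : set H :=
  [set p.1 + z^*%C *: p.2 | p in ortho (pair_dot dot) (graph T)].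

Lemma subspace_ortho (E : lmodType R[i]) (dot : {dot E for Num.conj}) M :
  subspace (ortho dot M).
Proof.
split=> [m _|a p q op oq m Mm]; first by rewrite linear0l.
by rewrite dotDl dotZl op // oq // mulr0 addr0.
Qed.

Lemma subspace_adjoint_range dot T z : subspace (adjoint_range dot T z).
Proof.
have [s0 sD] := subspace_ortho (pair_dot dot) (graph T).
split; first by exists 0; rewrite //= scaler0 addr0.
move=> a _ _ [p Tp <-] [q Tq <-]; exists (a *: p + q); first exact: sD.
by rewrite /= !scalerDr addrACA !scalerA mulrC.
Qed.

End operators.

Section separable_hilbert.
Variables (R : realType) (H : completeNormedModType R[i]).
Variables (dot : {dot H for Num.conj}) (dot_norm : induces_norm dot).
Variables (D : nat -> H).
Hypothesis D_dense : forall p (e : R), 0 < e -> exists n, rnorm (D n - p) < e.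

Lemma dense_sequenceP (M : set H) : closure M = setT <->
  forall n k, exists2 m, M m & rnorm (m - D n) < k.+1%:R^-1.
Proof.
split=> [MT n k|MD].
  have : closure M (D n) by rewrite MT.
  move=> /(_ [set y | rnorm (y - D n) < k.+1%:R^-1])[].
    by apply/nbhs_rnormP; exists k.+1%:R^-1.
  by move=> m [Mm /= mk]; exists m.
rewrite -subTset => y _ B /nbhs_rnormP[e e0 yB].
have e20 : 0 < e / 2 by lra.
have [n ny] := D_dense y e20; have [k ke] := exists_invS_lt e20.
have [m Mm mn] := MD n k; exists m; split=> //; apply: yB.
have := lt_trans mn ke; have := rnormB_triangle (D n) m y; lra.
Qed.

(** A vector f is orthogonal to the adjoint range exactly when (f, z f) is
    orthogonal to the complement of the graph, which for a closed graph means
    that (f, z f) lies in the graph. *)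
Lemma eigenvaluesP (T : operator H) z : closed_operator T ->
  (~ eigenvalues T z) <-> closure (adjoint_range dot T z) = setT.
Proof.
move=> cT; rewrite (dense_subspaceP (hilbert_dot_induced dot_norm)); last first.
  exact: subspace_adjoint_range.
have dotE f p : dot f (p.1 + z^*%C *: p.2) = pair_dot dot (f, z *: f) p.
  by rewrite linearDr /= dotZr conjcK -dotZl.
split=> [nz f of_|noz [f [Tf f0 Tfz]]].
  apply: contrapT => f0; apply: nz; exists f.
  have /graphP[Tf fz] : graph T (f, z *: f).
    apply: (ortho_ortho (hilbert_dot_pair dot_norm)) => //.
      exact: subspace_graph.
    by move=> p op; rewrite -dotE; apply: of_; exists p.
  by split=> //; exact/eqP.
move/eqP: f0; apply; apply: noz => _ [p op <-].
rewrite dotE dotC (op (f, z *: f)) ?conjc0 //.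
by apply/graphP.
Qed.

(** The openness needed for [measurable_forall_compact], for both orders of the
    components of a pair: the adjoint uses [fst] and [snd], the graph itself
    uses [snd] and [fst]. *)
Lemma open_shift (s : CC R -> CC R) (a b : H * H -> H) (y : H) (r : R) :
  continuous s -> continuous a -> continuous b ->
  open [set x : CC R * (H * H) | rnorm (a x.2 + s x.1 *: b x.2 - y) < r].
Proof.
move=> cs ca cb; pose f (x : CC R * (H * H)) : H := a x.2 + s x.1 *: b x.2.
have cf : continuous f.
  move=> x.
  have c1 : (fun x : CC R * (H * H) => s x.1) @ nbhs x --> nbhs (s x.1).
    apply: (@cvg_comp _ _ _ fst s (nbhs x) (nbhs x.1)); first exact: cvg_fst.
    exact: cs.
  have c21 : (fun x : CC R * (H * H) => a x.2) @ nbhs x --> nbhs (a x.2).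
    apply: (@cvg_comp _ _ _ snd a (nbhs x) (nbhs x.2)); first exact: cvg_snd.
    exact: ca.
  have c22 : (fun x : CC R * (H * H) => b x.2) @ nbhs x --> nbhs (b x.2).
    apply: (@cvg_comp _ _ _ snd b (nbhs x) (nbhs x.2)); first exact: cvg_snd.
    exact: cb.
  apply: cvgD; first exact: c21.
  exact: (cvg_comp _ _ (cvg_pair c1 c22) (@scale_continuous _ H (s x.1, b x.2))).
apply: (open_comp (f := f) (D := [set q | rnorm (q - y) < r])) => [x _|].
  exact: cf.
exact: open_rnorm_lt.
Qed.

Lemma continuous_conj : continuous (fun z : CC R => (z^*%C : CC R)).
Proof.
move=> z A /nbhs_rnormP[e e0 zA]; apply/nbhs_rnormP; exists e => // y ye.
by apply: zA; rewrite -rmorphB rnorm_conj.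
Qed.

Variables (d : measure_display) (Omega : measurableType d).
Variables (X : Omega -> operator H) (X_closed : random_closed_operator X).

(** Missing a closed square means that the adjoint ranges are dense at all its
    points. *)
Lemma random_eigenvalues : random_set (fun w => eigenvalues (X w)).
Proof.
have [rX cX] := X_closed.
have rO : random_set (fun w => ortho (pair_dot dot) (graph (X w))).
  apply: (random_ortho (hilbert_dot_pair dot_norm)
    (pair_dot_dense dot_norm D_dense)) => //.
  by move=> w; exact: subspace_graph.
apply: random_set_csquare => i.
pose O n k := [set x : CC R * (H * H) |
  rnorm (x.2.1 + x.1^*%C *: x.2.2 - D n) < k.+1%:R^-1].
pose A n k := [set w | forall z, csquare i z ->
  exists2 p, ortho (pair_dot dot) (graph (X w)) p & O n k (z, p)].
have -> : [set w | eigenvalues (X w) `&` csquare i !=set0] =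
    ~` \bigcap_n \bigcap_k A n k.
  apply/seteqP; split=> [w [z [Xz iz]] Aw|w nAw].
    suff : ~ eigenvalues (X w) z by [].
    apply/eigenvaluesP => //; apply/dense_sequenceP => n k.
    have [p Xp pO] := Aw n Logic.I k Logic.I z iz.
    by exists (p.1 + z^*%C *: p.2) => //; exists p.
  apply: contrapT => nXi; apply: nAw => n _ k _ z iz.
  have /eigenvaluesP : ~ eigenvalues (X w) z by move=> Xz; apply: nXi; exists z.
  move=> /(_ (cX w)) /dense_sequenceP/(_ n k)[_ [p Xp <-] pn].
  by exists p.
apply: measurableC; apply: bigcapT_measurable => n.
apply: bigcapT_measurable => k; apply: measurable_forall_compact => //.
  by apply: (@open_shift _ fst snd) => [||p]; [exact: continuous_conj|
    move=> p; exact: cvg_fst|exact: cvg_snd].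
exact: compact_csquare.
Qed.

End separable_hilbert.

(** * The closed graph theorem *)

Section closed_graph.
Variables (R : realType) (H : completeNormedModType R[i]).

(** Serves both the nested balls of the Baire argument, where [b] is the radius,
    and the successive approximations, where [b] is the tail of a geometric
    series. *)
Lemma telescope_cvg (u : nat -> H) (b : nat -> R) :
  (forall k, 0 <= b k) -> (forall e, 0 < e -> exists k, b k < e) ->
  (forall k, rnorm (u k.+1 - u k) <= b k - b k.+1) ->
  exists2 l : H, u @ \oo --> l & forall k, rnorm (u k - l) <= b k.
Proof.
move=> b0 b_small ub.
have u_le m n : (m <= n)%N -> rnorm (u n - u m) <= b m - b n.
  move=> /subnKC <-; elim: (n - m)%N => [|k IH].
    by rewrite addn0 !subrr rnorm0.
  rewrite addnS; have := rnormB_triangle (u (m + k)%N) (u (m + k).+1) (u m).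
  have := ub (m + k)%N; lra.
have [l ul] : exists l : H, u @ \oo --> l.
  apply: rnorm_cauchy => e e0; have [|N Ne] := b_small (e / 2); first by lra.
  exists N => m n Nm Nn; have := rnormB_triangle (u N) (u m) (u n).
  have := u_le _ _ Nm; have := u_le _ _ Nn; rewrite (rnorm_sub (u N)).
  have := b0 m; have := b0 n; lra.
exists l => // k; apply/ler_addgt0Pr => e e0.
have /cvg_rnormP/(_ e e0) ule := ul.
near \oo => n.
have kn : (k <= n)%N by near: n; exact: nbhs_infty_ge.
have une : rnorm (u n - l) < e by near: n.
have := rnormB_triangle (u n) (u k) l; have := u_le _ _ kn.
rewrite (rnorm_sub (u n)); have := b0 n; lra.
Unshelve. all: by end_near. Qed.

Lemma exists_half_pow_lt (c e : R) : 0 < e -> exists k, c * 2^-1 ^+ k < e.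
Proof.
move=> e0; have [c0|c0] := leP c 0.
  by exists 0%N; rewrite expr0 mulr1; lra.
have /cvgrPdist_lt/(_ (e / c)) : (fun k => 2^-1 ^+ k : R) @ \oo --> (0 : R).
  by apply: cvg_expr; rewrite ger0_norm; lra.
rewrite divr_gt0 // => /(_ isT)[k _ /(_ k (leqnn k))] /=.
rewrite sub0r normrN ger0_norm ?exprn_ge0 // => kc.
by exists k; rewrite mulrC -ltr_pdivlMr.
Qed.

Variable S : H -> H.
Hypothesis S_linear : forall (a : R[i]) u v, S (a *: u + v) = a *: S u + S v.
Hypothesis S_closed : forall (u : nat -> H) l m,
  u @ \oo --> l -> S \o u @ \oo --> m -> S l = m.

Let S0 : S 0 = 0.
Proof.
have := S_linear 1 0 0; rewrite !scale1r addr0 => /eqP.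
by rewrite addrC -subr_eq subrr eq_sym => /eqP.
Qed.

Let SB u v : S (u - v) = S u - S v.
Proof. by rewrite -scaleN1r addrC S_linear scaleN1r addrC. Qed.

Let SZ a u : S (a *: u) = a *: S u.
Proof. by rewrite -[_ *: u]addr0 S_linear S0 addr0. Qed.

(** Otherwise there are nested balls on the n-th of which [S] exceeds n, and the
    value of [S] at their common point exceeds every integer. *)
Lemma baire_level : exists n x, exists2 r : R, 0 < r &
  forall y, rnorm (y - x) < r -> closure [set a | rnorm (S a) <= n%:R] y.
Proof.
apply: contrapT => noball.
have step n (xr : H * R) : exists xr' : H * R, 0 < xr.2 ->
  [/\ 0 < xr'.2, xr'.2 <= xr.2 / 2, rnorm (xr'.1 - xr.1) <= xr.2 - xr'.2 &
      forall y, rnorm (y - xr'.1) <= xr'.2 -> n%:R < rnorm (S y)].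
  have [r0|] := pselect (0 < xr.2); last by exists xr.
  have [y [yx yn]] : exists y, rnorm (y - xr.1) < xr.2 /\
      ~ closure [set a | rnorm (S a) <= n%:R] y.
    apply: contrapT => H0; apply: noball; exists n, xr.1, xr.2 => // y yx.
    by apply: contrapT => yn; apply: H0; exists y.
  move: yn => /existsNP[B /not_implyP[/nbhs_rnormP[e e0 yB] nB]].
  pose r := Num.min (e / 2) (Num.min (xr.2 / 2) (xr.2 - rnorm (y - xr.1))).
  exists (y, r) => _; split => /=.
  - by rewrite !lt_min; apply/and3P; split; lra.
  - by rewrite !ge_min lexx orbT.
  - suff : r <= xr.2 - rnorm (y - xr.1) by lra.
    by rewrite !ge_min lexx !orbT.
  - move=> a ar; rewrite ltNge; apply/negP => an; apply: nB; exists a; split=> //.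
    apply: yB; apply: le_lt_trans ar _.
    by apply: (@le_lt_trans _ _ (e / 2)); [rewrite ge_min lexx|lra].
have [g gP] := choice (fun nxr => step nxr.1 nxr.2).
pose fix xr n : H * R := if n is k.+1 then g (k, xr k) else (0, 1).
have r_gt0 n : 0 < (xr n).2.
  by elim: n => [|n /(gP (n, xr n))[]//]; rewrite /= ltr01.
have xrP n := gP (n, xr n) (r_gt0 n).
have r_le n : (xr n).2 <= 1 * 2^-1 ^+ n.
  elim: n => [|n IH]; first by rewrite expr0 mulr1.
  have [_ + _ _] := xrP n; rewrite -/(xr n.+1) exprSr /=; lra.
have [l _ xl] : exists2 l : H, (fun n => (xr n).1) @ \oo --> l &
    forall n, rnorm ((xr n).1 - l) <= (xr n).2.
  apply: telescope_cvg => [k|e e0|k]; first exact: ltW.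
    by have [k ke] := exists_half_pow_lt 1 e0; exists k; exact: le_lt_trans ke.
  by have [] := xrP k.
have Sl n : n%:R < rnorm (S l).
  have [_ _ _ /(_ l) Sn] := xrP n; apply: Sn.
  by rewrite rnorm_sub; exact: (xl n.+1).
have := Sl (Num.truncn (rnorm (S l))).+1.
by rewrite ltNge => /negP; apply; apply: ltW; exact: truncnS_gt.
Qed.

(** The closure of a level set contains a ball; by symmetry and convexity it
    contains a ball around the origin, and scaling gives a linear bound. *)
Lemma approximate_bound : exists2 c : R, 0 <= c & forall y (e : R), 0 < e ->
  exists2 a, rnorm (S a) <= c * rnorm y & rnorm (y - a) < e.
Proof.
have [n [x [r r0 xr]]] := baire_level.
have near_le y (e : R) : rnorm y < r -> 0 < e ->
    exists2 a, rnorm (S a) <= n%:R & rnorm (y - a) < e.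
  move=> yr e0.
  (* y is half the difference of the points x + y and x - y of the ball. *)
  have xy_near v : rnorm v < r ->
      exists2 a, rnorm (S a) <= n%:R & rnorm (a - (x + v)) < e.
    move=> vr; have /(xr (x + v)) : rnorm (x + v - x) < r by rewrite addrC addKr.
    move=> /(_ [set a | rnorm (a - (x + v)) < e])[|a [Sa ae]]; last by exists a.
    by apply/nbhs_rnormP; exists e.
  have [a Sa ae] := xy_near y yr.
  have [|b Sb be] := xy_near (- y); first by rewrite rnormN.
  have half2 : `|2^-1 : R| = 2^-1 by rewrite ger0_norm; lra.
  exists ((2^-1 : R)%:C%C *: (a - b)).
    rewrite SZ SB rnormZ_real half2.
    have := rnormD (S a) (- S b); rewrite rnormN; lra.
  have -> : y - (2^-1 : R)%:C%C *: (a - b) =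
      (2^-1 : R)%:C%C *: ((b - (x - y)) - (a - (x + y))).
    have -> : b - (x - y) - (a - (x + y)) = y *+ 2 - (a - b).
      rewrite !opprB mulr2n (addrA b y) -(addrA x y) (addrA (b + y - x)) subrK.
      by rewrite (addrC b) addrACA.
    rewrite [in RHS]scalerBr -(scaler_nat 2 y) scalerA.
    suff -> : (2^-1 : R)%:C%C * 2 = 1 :> R[i] by rewrite scale1r.
    by rewrite -(rmorph_nat (real_complex R) 2) -rmorphM mulVf ?rmorph1.
  rewrite rnormZ_real half2.
  have := rnormD (b - (x - y)) (- (a - (x + y))); rewrite rnormN; lra.
exists (2 * n%:R / r); first by rewrite divr_ge0 // ?mulr_ge0 // ltW.
move=> y e e0; have [->|y0] := eqVneq y 0.
  by exists 0; rewrite ?S0 ?subrr rnorm0 ?mulr0.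
have ny : 0 < rnorm y by rewrite lt0r rnorm_eq0 y0 rnorm_ge0.
pose t := r / 2 / rnorm y; have t0 : 0 < t by rewrite !divr_gt0.
have ty : t * rnorm y = r / 2 by rewrite divfK ?gt_eqF.
have [||a Sa ae] := near_le (t%:C%C *: y) (t * e).
- by rewrite rnormZ_real gtr0_norm // ty; lra.
- exact: mulr_gt0.
have tV : t%:C%C^-1 = (t^-1)%:C%C :> R[i] by rewrite fmorphV.
have t0' : t%:C%C != 0 :> R[i] by rewrite fmorph_eq0 gt_eqF.
exists (t%:C%C^-1 *: a).
  rewrite SZ tV rnormZ_real gtr0_norm ?invr_gt0 // mulrC ler_pdivrMr //.
  have -> : 2 * n%:R / r * rnorm y * t = n%:R * (2 / r * (t * rnorm y)) by ring.
  rewrite ty; have -> : 2 / r * (r / 2) = 1 by field; exact: lt0r_neq0.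
  by rewrite mulr1.
have -> : y - t%:C%C^-1 *: a = t%:C%C^-1 *: (t%:C%C *: y - a).
  by rewrite scalerBr scalerA mulVf // scale1r.
by rewrite tV rnormZ_real gtr0_norm ?invr_gt0 // mulrC ltr_pdivrMr // mulrC.
Qed.

(** Approximating repeatedly with halved errors writes y as the sum of vectors
    on which [S] is geometrically small.  The remainders [v k] tend to 0 while
    their images converge, and closedness makes the limit of the images 0. *)
Lemma closed_graph_bounded : exists c : R, forall y, rnorm (S y) <= c * rnorm y.
Proof.
have [c c0 cS] := approximate_bound; exists (2 * c) => y.
have [->|y0] := eqVneq y 0; first by rewrite S0 rnorm0 mulr0.
have ny : 0 < rnorm y by rewrite lt0r rnorm_eq0 y0 rnorm_ge0.
have e0 k : 0 < rnorm y * 2^-1 ^+ k by rewrite mulr_gt0 // exprn_gt0; lra.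
have /choice[g gP] (kv : nat * H) : exists a,
    rnorm (S a) <= c * rnorm kv.2 /\ rnorm (kv.2 - a) < rnorm y * 2^-1 ^+ kv.1.+1.
  by have [a Sa av] := cS kv.2 _ (e0 kv.1.+1); exists a.
pose fix v k := if k is j.+1 then v j - g (j, v j) else y.
have v_le k : rnorm (v k) <= rnorm y * 2^-1 ^+ k.
  case: k => [|k]; first by rewrite expr0 mulr1.
  by have [_ /ltW] := gP (k, v k).
have [l Sv Sl] : exists2 l : H, S \o v @ \oo --> l &
    forall k, rnorm ((S \o v) k - l) <= 2 * c * rnorm y * 2^-1 ^+ k.
  apply: telescope_cvg => [k|e e0'|k].
  - by rewrite !mulr_ge0 ?rnorm_ge0 ?exprn_ge0; lra.
  - exact: exists_half_pow_lt.
  - have [Sg _] := gP (k, v k); rewrite /= SB addrAC subrr add0r rnormN.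
    apply: le_trans Sg _ => /=; have := ler_wpM2l c0 (v_le k).
    by rewrite exprS; lra.
have l0 : l = 0.
  rewrite -S0; apply/esym; apply: S_closed Sv.
  apply/cvg_rnormP => e /(exists_half_pow_lt (rnorm y))[N Ne].
  exists N => // k /= Nk; rewrite subr0; apply: le_lt_trans (v_le k) _.
  apply: le_lt_trans Ne; rewrite ler_pM2l //.
  by apply: ler_wiXn2l => //; lra.
by have := Sl 0%N; rewrite l0 subr0 expr0 mulr1.
Qed.

End closed_graph.

(** * The resolvent set *)

Section resolvent.
Variables (R : realType) (H : completeNormedModType R[i]).
Implicit Types T : operator H.

(** The bound runs over the inverses of integers, so that its existence is a
    countable union. *)
Definition bounded_below T (z : R[i]) (n : nat) :=
  forall f, Dom T f -> n.+1%:R^-1 * rnorm f <= rnorm (T f - z *: f).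

Lemma closed_shift T (z : R[i]) (f : nat -> H) f0 y : closed_operator T ->
  (forall n, Dom T (f n)) -> f @ \oo --> f0 ->
  (fun n => T (f n) - z *: f n) @ \oo --> y ->
  Dom T f0 /\ T f0 - z *: f0 = y.
Proof.
move=> cT Tf ff0 fy.
have Tcvg : (fun n => T (f n)) @ \oo --> y + z *: f0.
  have -> : (fun n => T (f n)) = (fun n => (T (f n) - z *: f n) + z *: f n).
    by apply/funext => n; rewrite subrK.
  by apply: cvgD => //; apply: cvgZr.
have /graphP[Tf0 <-] : graph T (f0, y + z *: f0).
  apply: (@closed_cvg _ _ \oo _ (fun n => (f n, T (f n))) _ cT).
    by apply: nearW => n; exists (f n).
  exact: (cvg_pair ff0 Tcvg).
by rewrite addrK.
Qed.

Lemma oper_shift_linear T (z a : R[i]) f g : Dom T f -> Dom T g ->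
  T (a *: f + g) - z *: (a *: f + g) = a *: (T f - z *: f) + (T g - z *: g).
Proof.
move=> Tf Tg; rewrite oper_linear // scalerDr scalerBr opprD addrACA.
by rewrite !scalerA mulrC.
Qed.

(** The inverse of [T - z] is everywhere defined and inherits a closed graph
    from [T]. *)
Lemma bijective_bounded_below T z : closed_operator T ->
  ~ spectrum T z -> exists n, bounded_below T z n.
Proof.
move=> cT /contrapT [_ inj surj].
have /choice[S SP] (y : H) : exists f, Dom T f /\ T f - z *: f = y.
  by have [f Tf fy] := surj y Logic.I; exists f.
have TS f : Dom T f -> S (T f - z *: f) = f.
  move=> Tf; have [TSf Sf] := SP (T f - z *: f).
  by apply: inj Sf; rewrite inE.
have [||c cP] := @closed_graph_bounded _ _ S.
- move=> a u v; have [[Tu uE] [Tv vE]] := (SP u, SP v).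
  rewrite -{1}uE -{1}vE -oper_shift_linear // TS //.
  exact: Dom_lin.
- move=> u l m ul Sum; suff [Tm <-] : Dom T m /\ T m - z *: m = l by rewrite TS.
  apply: (closed_shift cT _ Sum) => [n|].
    by have [] := SP (u n).
  by under eq_fun do rewrite (SP _).2.
have [n cn] : exists n, c <= n.+1%:R.
  by exists (Num.truncn c); apply/ltW/truncnS_gt.
exists n => f Tf; rewrite mulrC ler_pdivrMr // mulrC -{1}(TS f Tf).
apply: le_trans (cP _) _; apply: ler_wpM2r cn; exact: rnorm_ge0.
Qed.

(** Moving z by less than half the bound costs at most half of it. *)
Lemma bounded_below_near T z z' n : bounded_below T z n ->
  rnorm (z' - z : CC R) < (n.*2.+1.+1%:R)^-1 -> bounded_below T z' n.*2.+1.
Proof.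
move=> bT zz' f Tf; have := bT f Tf.
have -> : T f - z *: f = (T f - z' *: f) + (z' - z) *: f.
  by rewrite scalerBl addrA subrK.
have := rnormD (T f - z' *: f) ((z' - z) *: f); rewrite rnormZ.
have -> : (n.+1%:R^-1 : R) = 2 * (n.*2.+2)%:R^-1.
  by rewrite -doubleS -muln2 natrM invfM mulrCA divff ?mulr1 // pnatr_eq0.
have := ler_wpM2r (rnorm_ge0 f) (ltW zz').
move: (n.*2.+2%:R^-1) => x; lra.
Qed.

Lemma bounded_below_le T z m n : (m <= n)%N ->
  bounded_below T z m -> bounded_below T z n.
Proof.
move=> mn bT f Tf; apply: le_trans (bT f Tf); apply: ler_wpM2r.
  exact: rnorm_ge0.
by rewrite lef_pV2 ?posrE // ler_nat.
Qed.

(** With a bound from below, preimages of a convergent sequence are Cauchy, so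
    the range of [T - z] is closed as soon as the graph of [T] is. *)
Lemma spectrumP T z : closed_operator T -> (~ spectrum T z) <->
  (exists n, bounded_below T z n) /\ closure (shifted_range T z) = setT.
Proof.
move=> cT; split=> [nz|[[n bT] dT]].
  split; first exact: bijective_bounded_below.
  move: nz => /contrapT[_ _ surj]; rewrite -subTset => y _.
  apply: subset_closure; have [f Tf fy] := surj y Logic.I.
  by exists (f, T f) => //; exists f.
apply; split=> //.
  move=> f g; rewrite !inE => Tf Tg fg; apply/eqP; rewrite -subr_eq0 -rnorm_eq0.
  rewrite -scaleN1r addrC; have := bT _ (Dom_lin (-1) Tg Tf).
  rewrite oper_shift_linear // !scaleN1r fg addNr rnorm0 => le0.
  rewrite eq_le rnorm_ge0 andbT; move: le0; rewrite pmulr_rle0 //.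
move=> y _.
have /choice[f fP] (k : nat) : exists f, Dom T f /\
    rnorm (T f - z *: f - y) < 2^-1 ^+ k.
  have : closure (shifted_range T z) y by rewrite dT.
  move=> /(_ [set q | rnorm (q - y) < 2^-1 ^+ k])[].
    by apply/nbhs_rnormP; exists (2^-1 ^+ k) => //; rewrite exprn_gt0; lra.
  by move=> _ [[_ [f Tf <-] <-] /= fk]; exists f.
have pow_le k m : (k <= m)%N -> (2^-1 : R) ^+ m <= 2^-1 ^+ k.
  by move=> km; apply: ler_wiXn2l => //; lra.
have gy : (fun k => T (f k) - z *: f k) @ \oo --> y.
  apply/cvg_rnormP => e /(exists_half_pow_lt 1)[N Ne]; exists N => // k /= Nk.
  have [_ fk] := fP k; have := pow_le _ _ Nk; lra.
have [f0 ff0] : exists f0 : H, f @ \oo --> f0.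
  apply: rnorm_cauchy => e e0.
  have [N Ne] := exists_half_pow_lt (2 * n.+1%:R) e0; exists N => k m Nk Nm.
  have [[Tfk fk] [Tfm fm]] := (fP k, fP m).
  have := bT _ (Dom_lin (-1) Tfm Tfk).
  rewrite oper_shift_linear // !scaleN1r ![- _ + _]addrC mulrC ler_pdivrMr //.
  move=> /le_lt_trans; apply; apply: le_lt_trans Ne.
  rewrite [leRHS]mulrAC; apply: ler_wpM2r => //.
  have := rnormB_triangle y (T (f k) - z *: f k) (T (f m) - z *: f m).
  have := pow_le _ _ Nk; have := pow_le _ _ Nm; rewrite (rnorm_sub y); lra.
have [] := closed_shift cT (fun k => (fP k).1) ff0 gy.
by exists f0.
Qed.

Variables (dot : {dot H for Num.conj}) (dot_norm : induces_norm dot).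

(** For z' near a point z of the resolvent set, a vector y orthogonal to the
    range of [T - z'] vanishes: with y = (T - z) f, the image of f under
    [T - z'] is orthogonal to y but differs from it by at most half of the
    length of y. *)
Lemma closed_spectrum T : closed_operator T -> closed (spectrum T).
Proof.
move=> cT; rewrite -[spectrum T]setCK; apply: open_closedC; rewrite openE => z nz.
have [[n bT] _] := (spectrumP z cT).1 nz.
apply/nbhs_rnormP; exists (n.*2.+2%:R)^-1 => // z' zz'.
have b' := bounded_below_near bT zz'.
apply/spectrumP => //; split; first by exists n.*2.+1.
apply/(dense_subspaceP (hilbert_dot_induced dot_norm)) => [|y oy].
  exact: subspace_shifted_range.
move: nz => /contrapT[_ _ /(_ y Logic.I)[f Tf fy]].
have yE : y = (T f - z' *: f) + (z' - z) *: f.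
  by rewrite -fy scalerBl addrA subrK.
have ym : dot y (T f - z' *: f) = 0 by apply: oy; exists (f, T f) => //; exists f.
have : rnorm y <= rnorm ((z' - z) *: f).
  rewrite -(@ler_pXn2r _ 2) ?nnegrE ?rnorm_ge0 //.
  rewrite -!(nsq_rnorm dot_norm).
  have -> : (z' - z) *: f = y - (T f - z' *: f) by rewrite {1}yE addrAC subrr add0r.
  by rewrite (nsqB_ortho ym) lerDl nsq_ge0.
rewrite rnormZ; have := bT f Tf; rewrite fy.
have -> : (n.+1%:R^-1 : R) = 2 * (n.*2.+2)%:R^-1.
  by rewrite -doubleS -muln2 natrM invfM mulrCA divff ?mulr1 // pnatr_eq0.
have := ler_wpM2r (rnorm_ge0 f) (ltW zz').
move: zz' => /=; have : (0 : R) < n.*2.+2%:R^-1 by [].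
move: (n.*2.+2%:R^-1) => x x0 zz' H1 H2 H3.
have f0 : rnorm f <= 0.
  have : x * rnorm f <= 0 by lra.
  by rewrite pmulr_rle0.
apply/eqP; rewrite -rnorm_eq0; have := rnorm_ge0 y.
have := rnorm_ge0 f; rewrite eq_le; nra.
Qed.

End resolvent.

(** * Measurability of the spectrum *)

Section random_spectrum.
Variables (R : realType) (H : completeNormedModType R[i]).
Variables (D : nat -> H).
Hypothesis D_dense : forall p (e : R), 0 < e -> exists n, rnorm (D n - p) < e.

Lemma continuous_rnorm (E : normedModType R[i]) : continuous (@rnorm R E).
Proof.
move=> x A /nbhs_ballP[e /= e0 xA]; apply/nbhs_rnormP; exists e => // y yx.
apply: xA; rewrite -ball_normE /=.
have := rnormB_triangle y x 0; have := rnormB_triangle x y 0.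
rewrite !subr0 (rnorm_sub x y) => h1 h2.
by apply: le_lt_trans yx; rewrite ler_norml; apply/andP; split; lra.
Qed.

Lemma open_almost_eigen (z : R[i]) (c : R) :
  open [set p : H * H | rnorm (p.2 - z *: p.1) < c * rnorm p.1].
Proof.
pose f (p : H * H) : R := c * rnorm p.1 - rnorm (p.2 - z *: p.1).
have -> : [set p : H * H | rnorm (p.2 - z *: p.1) < c * rnorm p.1] =
    f @^-1` [set r | 0 < r].
  by apply/seteqP; split=> p /=; rewrite /f subr_gt0.
apply: open_comp => [p _|]; last exact: open_gt.
apply: cvgB.
  apply: cvgM; first exact: cvg_cst.
  apply: (@cvg_comp _ _ _ fst (@rnorm R H) (nbhs p) (nbhs p.1)).
    exact: cvg_fst.
  exact: continuous_rnorm.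
have c2 : (fun p : H * H => p.2 - z *: p.1) @ nbhs p --> nbhs (p.2 - z *: p.1).
  apply: cvgB; first exact: cvg_snd.
  by apply: cvgZr; exact: cvg_fst.
exact: (cvg_comp _ _ c2 (@continuous_rnorm H _)).
Qed.

(** The bound is locally uniform in z, hence uniform on compact sets. *)
Lemma bounded_below_compact (T : operator H) (K : set (CC R)) : compact K ->
  (forall z, K z -> exists n, bounded_below T z n) ->
  exists n, forall z, K z -> bounded_below T z n.
Proof.
move=> /compact_near_coveringP cK KT.
have [|n _ nK] := cK nat \oo (fun n z => bounded_below T z n) _.
  move=> z /KT[n bT]; near=> z' m => /=.
  apply: bounded_below_le (bounded_below_near bT _).
    near: m; exact: nbhs_infty_ge.
  near: z'; apply/nbhs_rnormP.
  by exists (n.*2.+2%:R)^-1.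
by exists n => z Kz; exact: (nK n (leqnn n) z Kz).
Unshelve. all: by end_near. Qed.

Variables (d : measure_display) (Omega : measurableType d).
Variables (X : Omega -> operator H) (X_closed : random_closed_operator X).

(** Missing a closed square means a uniform bound from below on it and dense
    ranges at all its points. *)
Lemma random_spectrum : random_set (fun w => spectrum (X w)).
Proof.
have [rX cX] := X_closed.
apply: random_set_csquare => i.
(* The graph avoids [W n] exactly when the bound 1 / (n + 1) holds at all
   points of the square. *)
pose W n := \bigcup_(z in csquare i)
  [set p : H * H | rnorm (p.2 - z *: p.1) < n.+1%:R^-1 * rnorm p.1].
pose B n := [set w | graph (X w) `&` W n !=set0].
pose O n k := [set x : CC R * (H * H) |
  rnorm (x.2.2 + (- x.1) *: x.2.1 - D n) < k.+1%:R^-1].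
pose A n k := [set w | forall z, csquare i z ->
  exists2 p, graph (X w) p & O n k (z, p)].
have -> : [set w | spectrum (X w) `&` csquare i !=set0] =
    ~` (\bigcup_n ~` B n `&` \bigcap_n \bigcap_k A n k).
  apply/seteqP; split=> [w [z [Xz iz]] [[m _ nB] Aw]|w nw].
    suff : ~ spectrum (X w) z by [].
    apply/spectrumP => //; split.
      exists m => f Xf; rewrite leNgt; apply/negP => fz; apply: nB.
      by exists (f, X w f); split; [exists f|exists z].
    apply/(dense_sequenceP D_dense) => n k.
    have [p Xp pO] := Aw n Logic.I k Logic.I z iz.
    by exists (p.2 - z *: p.1); [exists p|rewrite -scaleNr].
  apply: contrapT => nXi; apply: nw.
  have res z : csquare i z -> ~ spectrum (X w) z.
    by move=> iz Xz; apply: nXi; exists z.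
  split.
    have [|m mP] := @bounded_below_compact (X w) _ (@compact_csquare R i).
      by move=> z /res /(spectrumP z (cX w))[].
    exists m => // -[_ [[f Xf <-] [z iz /=]]].
    by rewrite ltNge mP.
  move=> n _ k _ z iz; have /(spectrumP z (cX w))[_] := res z iz.
  move=> /(dense_sequenceP D_dense)/(_ n k)[_ [p Xp <-] pn].
  by exists p => //; rewrite /O /= scaleNr.
apply: measurableC; apply: measurableI.
  apply: bigcupT_measurable => n; apply: measurableC; apply: rX.
  by apply: bigcup_open => z _; exact: open_almost_eigen.
apply: bigcapT_measurable => n; apply: bigcapT_measurable => k.
apply: measurable_forall_compact => //; last exact: compact_csquare.
apply: (@open_shift _ _ -%R snd fst) => p; [exact: opp_continuous|
  exact: cvg_snd|exact: cvg_fst].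
Qed.

End random_spectrum.

(** * Invariance under equivalence, and the theorem *)

Section unitary.
Variables (R : realType) (H : lmodType R[i]).

Lemma similar_eigenvalues (S T : operator H) (V V' : {linear H -> H}) :
  cancel V V' -> cancel V' V -> Dom S = V' @^-1` Dom T ->
  (forall f, Dom S f -> S f = V (T (V' f))) -> eigenvalues S = eigenvalues T.
Proof.
move=> VK V'K DS ST; apply/seteqP; split=> z [f [Tf f0 fz]].
  exists (V' f); split; first by rewrite DS in Tf.
    by apply: contra_neq f0 => V'f; rewrite -(V'K f) V'f linear0.
  by rewrite -linearZ -fz ST // VK.
have SVf : Dom S (V f) by rewrite DS /= VK.
exists (V f); split=> //; last by rewrite ST // VK fz linearZ.
by apply: contra_neq f0 => Vf; rewrite -(VK f) Vf linear0.
Qed.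

Lemma similar_spectrum (S T : operator H) (V V' : {linear H -> H}) :
  cancel V V' -> cancel V' V -> Dom S = V' @^-1` Dom T ->
  (forall f, Dom S f -> S f = V (T (V' f))) -> spectrum S = spectrum T.
Proof.
move=> VK V'K DS ST.
have shift z f : Dom S f -> S f - z *: f = V (T (V' f) - z *: V' f).
  by move=> Sf; rewrite linearB (linearZ_LR V) V'K ST.
have DSV f : Dom T f -> Dom S (V f) by rewrite DS /= VK.
suff bij z : set_bij (Dom S) setT (fun f => S f - z *: f) <->
    set_bij (Dom T) setT (fun f => T f - z *: f).
  by apply/seteqP; split=> z + /bij.
split=> -[_ inj surj]; split=> //.
- move=> f g; rewrite !inE => Tf Tg fg; apply: (can_inj VK).
  apply: inj; rewrite ?inE; try exact: DSV.
  by rewrite !shift ?VK ?fg //; exact: DSV.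
- move=> y _; have [f Sf fy] := surj (V y) Logic.I.
  exists (V' f); first by rewrite DS in Sf.
  by apply: (can_inj VK); rewrite -shift.
- move=> f g; rewrite !inE => Sf Sg; rewrite !shift // => /(can_inj VK) fg.
  by apply: (can_inj V'K); apply: inj; rewrite ?inE //; rewrite DS in Sf Sg.
- move=> y _; have [f Tf fy] := surj (V' y) Logic.I.
  exists (V f); first exact: DSV.
  by rewrite shift ?VK ?fy ?V'K //; exact: DSV.
Qed.

End unitary.

Theorem theorem1 (R : realType) (d : measure_display) (Omega : measurableType d)
    (P : {measure set Omega -> \bar R})
    (P_renyi : renyi_measure P) (P_complete : measure_is_complete P)
    (H : completeNormedModType R[i]) (dot : {dot H for Num.conj})
    (dot_norm : induces_norm dot) (H_separable : separable H)
    (X : Omega -> operator H) (X_closed : random_closed_operator X) :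
  (random_set (fun w => eigenvalues (X w)) /\
   random_set (fun w => spectrum (X w))) /\
  (forall Tau : set (Omega -> Omega),
    (forall tau, Tau tau -> measurable_fun [set: Omega] tau) ->
    metrically_transitive P Tau ->
    unitarily_invariant P dot Tau X ->
    exists Fp F : set (CC R),
      [/\ closed Fp, closed F,
          \forall w \ae P, closure (eigenvalues (X w)) = Fp &
          \forall w \ae P, spectrum (X w) = F]).
Proof.
have [D D_dense] := separable_sequence H_separable.
have r_eig := random_eigenvalues dot_norm D_dense X_closed.
have r_spec := random_spectrum D_dense X_closed.
split=> // Tau mTau tTau XTau.
have [Fp cFp eFp] : exists2 Fp, closed Fp &
    \forall w \ae P, closure (eigenvalues (X w)) = Fp.
  apply: (random_set_closure_constant mTau tTau r_eig) => tau /XTau.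
  by apply: filterS => w [V [V' [[_ VK V'K] DS ST]]]; exact: similar_eigenvalues ST.
have [F cF eF] : exists2 F, closed F &
    \forall w \ae P, closure (spectrum (X w)) = F.
  apply: (random_set_closure_constant mTau tTau r_spec) => tau /XTau.
  by apply: filterS => w [V [V' [[_ VK V'K] DS ST]]]; exact: similar_spectrum ST.
exists Fp, F; split=> //.
apply: filterS eF => w <-; apply/closure_id.
by apply: (closed_spectrum dot_norm); exact: X_closed.2.
Qed.
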